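(* Let $X$ be a Banach space over $\mathbb F$, where $\mathbb F=\mathbb R$ or $\mathbb F=\mathbb C$, and let $\mathcal A\subseteq B(X)$ be a standard operator algebra, i.e. a subalgebra of $B(X)$ containing every finite rank operator in $B(X)$. Then every local derivation $\delta:\mathcal A\to B(X)$ is a derivation.
   Context: $B(X)$ is the algebra of all bounded linear operators on $X$, and $F(X)\subseteq B(X)$ is the set of bounded operators whose range is finite dimensional. A standard operator algebra on $X$ is a subalgebra $\mathcal A$ of $B(X)$ with $F(X)\subseteq\mathcal A$; it is not assumed to be norm closed or to contain the identity operator. $B(X)$ is regarded as an $\mathcal A$-bimodule via operator multiplication. A derivation from $\mathcal A$ into $B(X)$ is an $\mathbb F$-linear mapping $\delta:\mathcal A\to B(X)$ with $\delta(AB)=\delta(A)B+A\delta(B)$ for all $A,B\in\mathcal A$ (no continuity is assumed). A local derivation from $\mathcal A$ into $B(X)$ is an $\mathbb F$-linear mapping $\delta:\mathcal A\to B(X)$ such that for every $A\in\mathcal A$ there is a derivation $\delta_A:\mathcal A\to B(X)$ (depending on $A$) with $\delta(A)=\delta_A(A)$. *)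

(* Defs.v *)
From HB Require Import structures.
From mathcomp Require Import all_boot all_order all_algebra complex.
From mathcomp Require Import all_classical all_reals topology normedtype.

Set Implicit Arguments.
Unset Strict Implicit.
Unset Printing Implicit Defensive.

Import Order.TTheory GRing.Theory Num.Theory.
Import numFieldNormedType.Exports.

Local Open Scope classical_set_scope.
Local Open Scope ring_scope.
Local Open Scope complex_scope.

Inductive real_or_complex : numFieldType -> Prop :=
| RealScalars (R : realType) : real_or_complex R
| ComplexScalars (R : realType) : real_or_complex R[i].

Section BoundedOperators.
Variables (K : numFieldType) (X : normedModType K).

(* Over [K = R[i]] norms are complex numbers, and [a <= b] says that [b - a]
   is real and nonnegative. *)
Definition bounded_linear (f : X -> X) : Prop :=
  linear f /\ exists M : K, forall x, `|f x| <= M * `|x|.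

Definition bounded_linear_pred : {pred X -> X} :=
  fun f => `[< bounded_linear f >].

Lemma bounded_linear_real_bound (f : X -> X) : bounded_linear f ->
  exists2 M : K, 0 <= M & forall x, `|f x| <= M * `|x|.
Proof.
move=> [fL [M hM]].
have [X0|/existsNP[x0 /eqP x0N0]] := pselect (forall x : X, x = 0).
  exists 0 => // x; have fx0 : f x = 0 by exact: X0.
  by rewrite fx0 normr0 mul0r.
exists M => //; have := le_trans (normr_ge0 _) (hM x0).
by rewrite pmulr_lge0 // normr_gt0.
Qed.

Lemma bounded_linear_submod : submod_closed bounded_linear_pred.
Proof.
split=> [|a f g /asboolP fB /asboolP gB]; apply/asboolP.
  split=> [c x y|]; first by change (0 = c *: 0 + 0 :> X); rewrite scaler0 addr0.
  by exists 0 => x; change (`|0 : X| <= 0 * `|x|); rewrite normr0 mul0r.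
have afgE x : (a *: f + g) x = a *: f x + g x by [].
split=> [c x y|].
  rewrite !afgE fB.1 gB.1 !scalerDr !scalerA (mulrC a c) -!addrA.
  by congr (_ + _); rewrite addrCA.
have [M _ fM] := bounded_linear_real_bound fB.
have [N _ gN] := bounded_linear_real_bound gB.
exists (`|a| * M + N) => x; rewrite afgE mulrDl.
rewrite (le_trans (ler_normD _ _))// lerD// normrZ -mulrA.
by rewrite ler_wpM2l.
Qed.

HB.instance Definition _ :=
  GRing.isSubmodClosed.Build K (X -> X) bounded_linear_pred
    bounded_linear_submod.

Record bounded_op := BoundedOp {
  bounded_op_fun :> X -> X;
  bounded_op_subproof : bounded_op_fun \in bounded_linear_pred }.

HB.instance Definition _ := [isSub for bounded_op_fun].
HB.instance Definition _ := [Choice of bounded_op by <:].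
HB.instance Definition _ := [SubChoice_isSubLmodule of bounded_op by <:].

Implicit Types S T U : bounded_op.

Lemma bounded_opP T : bounded_linear T.
Proof. exact/asboolP/bounded_op_subproof. Qed.

Lemma bounded_op_ext S T : S =1 T -> S = T.
Proof. by move=> ST; apply/val_inj/funext. Qed.

Lemma bounded_op_addE S T x : (S + T) x = S x + T x.
Proof. by []. Qed.

Lemma bounded_op_scaleE c T x : (c *: T) x = c *: T x.
Proof. by []. Qed.

Lemma bounded_opD T x y : T (x + y) = T x + T y.
Proof. by rewrite -[x]scale1r (bounded_opP T).1 !scale1r. Qed.

Lemma bounded_opZ T c x : T (c *: x) = c *: T x.
Proof.
have [TL _] := bounded_opP T.
have T0 : T 0 = 0.
  by apply: (addrI (T 0)); rewrite -bounded_opD !addr0.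
by rewrite -[c *: x]addr0 TL T0 addr0.
Qed.

Lemma bounded_op_one_subproof : (id : X -> X) \in bounded_linear_pred.
Proof. by apply/asboolP; split=> //; exists 1 => x; rewrite mul1r. Qed.

Definition bounded_op_one := BoundedOp bounded_op_one_subproof.

Lemma bounded_op_mul_subproof S T : S \o T \in bounded_linear_pred.
Proof.
apply/asboolP; split=> [c x y|] /=; first by rewrite !bounded_opD !bounded_opZ.
have [M M0 SM] := bounded_linear_real_bound (bounded_opP S).
have [N _ TN] := bounded_linear_real_bound (bounded_opP T).
exists (M * N) => x /=; rewrite (le_trans (SM _))// -mulrA.
by rewrite ler_wpM2l.
Qed.

Definition bounded_op_mul S T := BoundedOp (bounded_op_mul_subproof S T).

Fact bounded_op_mulA : associative bounded_op_mul.
Proof. by move=> S T U; apply: bounded_op_ext. Qed.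

Fact bounded_op_mul1l : left_id bounded_op_one bounded_op_mul.
Proof. by move=> T; apply: bounded_op_ext. Qed.

Fact bounded_op_mul1r : right_id bounded_op_one bounded_op_mul.
Proof. by move=> T; apply: bounded_op_ext. Qed.

Fact bounded_op_mulDl : left_distributive bounded_op_mul +%R.
Proof. by move=> S T U; apply: bounded_op_ext. Qed.

Fact bounded_op_mulDr : right_distributive bounded_op_mul +%R.
Proof. by move=> S T U; apply: bounded_op_ext => x; exact: bounded_opD. Qed.

HB.instance Definition _ := GRing.Zmodule_isPzRing.Build bounded_op
  bounded_op_mulA bounded_op_mul1l bounded_op_mul1r
  bounded_op_mulDl bounded_op_mulDr.

(* There is no [lalgType] instance because the library's algebras are
   nontrivial rings, which fails for [X = 0]. *)
Lemma bounded_op_scaleAl c S T : c *: (S * T) = (c *: S) * T.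
Proof. exact: bounded_op_ext. Qed.

Lemma bounded_op_scaleAr c S T : c *: (S * T) = S * (c *: T).
Proof. by apply: bounded_op_ext => x; rewrite /= bounded_opZ. Qed.

Lemma bounded_op_mulE S T x : (S * T) x = S (T x).
Proof. by []. Qed.

Definition lin_span n (v : 'I_n -> X) : set X :=
  range (fun c : 'I_n -> K => \sum_(i < n) c i *: v i).

Definition finite_rank T : Prop :=
  exists (n : nat) (v : 'I_n -> X), range T = lin_span v.

(* [mulr_2closed] rather than the library's [mulr_closed], because [A] need not
   contain the identity operator. *)
Definition standard_operator_algebra (A : {pred bounded_op}) : Prop :=
  [/\ submod_closed A, GRing.mulr_2closed A &
      forall T, finite_rank T -> T \in A].

(* A mapping from [A] to [bounded_op] is represented by a total function whose
   values outside [A] are irrelevant. *)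
Definition linear_on (A : {pred bounded_op})
    (d : bounded_op -> bounded_op) : Prop :=
  forall c : K, {in A &, forall S T, d (c *: S + T) = c *: d S + d T}.

Definition derivation (A : {pred bounded_op})
    (d : bounded_op -> bounded_op) : Prop :=
  linear_on A d /\ {in A &, forall S T, d (S * T) = d S * T + S * d T}.

Definition local_derivation (A : {pred bounded_op})
    (d : bounded_op -> bounded_op) : Prop :=
  linear_on A d /\
  {in A, forall T, exists2 dT, derivation A dT & d T = dT T}.

End BoundedOperators.

Arguments bounded_op {K} X.
Notation "''B(' X )" := (bounded_op X) (format "''B(' X )") : type_scope.

(* Main.v *)
(* By Hahn-Banach the rank-one operators separate: [T = 0] as soon as all [S T],
   or all [T S], with [S] of rank one vanish. For [S T = 0 = T U] one gets
   [S delta(T) U = 0], since [delta] agrees with a derivation at [T]. Applied to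
   [S (1 - P)], [P T], [U] and to [S P], [T - P T], [U] with [P] idempotent and
   [T U = 0], this gives [delta(P T) U = P delta(T) U], and by linearity [P] may
   be any rank-one operator. Splitting [T] as [T Q + T (1 - Q)] with [Q]
   idempotent then yields
     [delta(F T G) = F delta(T G) + delta(F T) G - F delta(T) G]
   for [F], [G] of rank one. Taking for [T] an idempotent [E] with [F E = F] and
   [E G = G], where [E delta(E) E = 0], gives the product rule on rank-one
   operators; multiplying by rank-one operators extends it to [A]. *)

Require Import Defs.
From mathcomp Require Import all_boot all_order all_algebra complex.
From mathcomp Require Import all_classical all_reals topology normedtype.
From mathcomp Require Import ring lra.

Set Implicit Arguments.
Unset Strict Implicit.
Unset Printing Implicit Defensive.

Import Order.TTheory GRing.Theory Num.Theory.
Import numFieldNormedType.Exports.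

Local Open Scope classical_set_scope.
Local Open Scope ring_scope.
Local Open Scope complex_scope.

(** * The Hahn-Banach theorem for sublinear functionals *)

Section HahnBanach.
(* [emb] makes [V] a real vector space, so that real and complex scalars are
   treated alike. *)
Variables (R : realType) (K : pzRingType) (emb : {rmorphism R -> K}).
Variable V : lmodType K.
Implicit Types (p q : V -> R) (F : set (V -> R)) (x y : V).

Definition sublinear p :=
  (forall x y, p (x + y) <= p x + p y) /\
  (forall a x, 0 < a -> p (emb a *: x) <= a * p x).

Lemma sublinear0 p : sublinear p -> p 0 = 0.
Proof.
move=> [pD pZ]; have := pD 0 0; rewrite addr0.
have : p 0 <= 2^-1 * p 0.
  by have := pZ 2^-1 0; rewrite scaler0; apply; rewrite invr_gt0.
lra.
Qed.

Lemma sublinearN_ge p x : sublinear p -> - p (- x) <= p x.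
Proof.
move=> ps; have := ps.1 x (- x); rewrite subrr (sublinear0 ps); lra.
Qed.

Lemma sublinearZ p a x : sublinear p -> 0 <= a -> p (emb a *: x) = a * p x.
Proof.
move=> ps; rewrite le_eqVlt => /predU1P[<-|a0].
  by rewrite rmorph0 scale0r mul0r sublinear0.
apply/le_anti; rewrite ps.2//= -ler_pdivlMl//.
have := ps.2 a^-1 (emb a *: x); rewrite scalerA -rmorphM mulVf ?gt_eqF//.
by rewrite rmorph1 scale1r invr_gt0; exact.
Qed.

Definition pointwise_inf F : V -> R := fun x => inf [set q x | q in F].

Lemma pointwise_inf_le F q x : F q -> (exists m, forall r, F r -> m <= r x) ->
  pointwise_inf F x <= q x.
Proof.
move=> Fq [m Fm]; apply: ge_inf; last by exists q.
by exists m => _ [r Fr <-]; exact: Fm.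
Qed.

Lemma le_pointwise_inf F q m x : F q -> (forall r, F r -> m <= r x) ->
  m <= pointwise_inf F x.
Proof.
move=> Fq Fm; apply: lb_le_inf; first by exists (q x), q.
by move=> _ [r Fr <-]; exact: Fm.
Qed.

(** The member [h] may vary with [f] and [g]: in a chain it is the smaller of the two, among
    translates their parameters add. *)
Lemma sublinear_pointwise_inf F q : F q ->
  (forall x, exists m, forall r, F r -> m <= r x) ->
  (forall f g x y, F f -> F g -> exists2 h, F h & h (x + y) <= f x + g y) ->
  (forall f a x, F f -> 0 < a -> exists2 h, F h & h (emb a *: x) <= a * f x) ->
  sublinear (pointwise_inf F).
Proof.
move=> Fq Flb FD FZ; split=> [x y|a x a0].
  rewrite -lerBlDl; apply: le_pointwise_inf (Fq) _ => g Fg.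
  rewrite lerBlDl -lerBlDr; apply: le_pointwise_inf (Fq) _ => f Ff.
  have [h Fh hfg] := FD f g x y Ff Fg.
  by rewrite lerBlDr (le_trans _ hfg)// pointwise_inf_le.
rewrite -ler_pdivrMl//; apply: le_pointwise_inf (Fq) _ => f Ff.
have [h Fh hf] := FZ f a x Ff a0.
by rewrite ler_pdivrMl// (le_trans _ hf)// pointwise_inf_le.
Qed.

(** For sublinear [p], the infimum over [t >= 0] is a sublinear minorant of [p] whose value at [- y]
    is at most [- p y]. *)
Definition translates p y : set (V -> R) :=
  [set (fun x => p (x + emb t *: y) - t * p y) | t in [set t | 0 <= t]].

Lemma translates_id p y : translates p y p.
Proof.
exists 0 => //=; apply/funext => x.
by rewrite rmorph0 scale0r addr0 mul0r subr0.
Qed.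

Lemma translates_lb p y : sublinear p ->
  forall x, exists m, forall r, translates p y r -> m <= r x.
Proof.
move=> ps x; exists (- p (- x)) => _ [t /= t0 <-].
have := ps.1 (x + emb t *: y) (- x).
rewrite addrAC subrr add0r (sublinearZ _ ps t0); lra.
Qed.

Lemma sublinear_translates p y : sublinear p ->
  sublinear (pointwise_inf (translates p y)).
Proof.
move=> ps; have lb := translates_lb y ps.
apply: sublinear_pointwise_inf (translates_id p y) (lb) _ _.
  move=> _ _ x z [s /= s0 <-] [t /= t0 <-].
  exists (fun x => p (x + emb (s + t) *: y) - (s + t) * p y).
    by exists (s + t) => //=; rewrite addr_ge0.
  rewrite rmorphD scalerDl addrACA.
  have := ps.1 (x + emb s *: y) (z + emb t *: y); lra.
move=> _ a x [t /= t0 <-] a0.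
exists (fun x => p (x + emb (a * t) *: y) - (a * t) * p y).
  by exists (a * t) => //=; rewrite mulr_ge0// ltW.
rewrite rmorphM -scalerA -scalerDr (sublinearZ _ ps (ltW a0)); lra.
Qed.

Lemma translates_inf_le p y t x : sublinear p -> 0 <= t ->
  pointwise_inf (translates p y) x <= p (x + emb t *: y) - t * p y.
Proof.
move=> ps t0.
by apply: (@pointwise_inf_le _ (fun x => p (x + emb t *: y) - t * p y));
  [exists t | exact: translates_lb].
Qed.

(** Zorn's lemma for the reversed pointwise order: a chain has its pointwise infimum as bound, which
    is finite because every member is at least [- p (- x)] at [x]. *)
Lemma minimal_sublinear p : sublinear p ->
  exists q, [/\ sublinear q, forall x, q x <= p x &
    forall r, sublinear r -> (forall x, r x <= q x) -> forall x, q x <= r x].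
Proof.
move=> ps; pose T := {q | sublinear q /\ forall x, q x <= p x}.
pose le (s t : T) := `[< forall x, sval t x <= sval s x >].
pose top : T := exist _ p (conj ps (fun x => lexx (p x))).
have [||A Atot|[q [qs qp]] qmin] := @ZL_preorder T top le.
- by move=> t; apply/asboolP.
- move=> r s t /asboolP rs /asboolP st; apply/asboolP => x.
  exact: le_trans (st x) (rs x).
- have [[q0 Aq0]|A0] := pselect (exists q : T, A q); last first.
    by exists top => s As; case: A0; exists s.
  pose F := [set sval s | s in A].
  have Fq0 : F (sval q0) by exists q0.
  have Flb x : exists m, forall r, F r -> m <= r x.
    exists (- p (- x)) => _ [[r [rs rp]] _ <-] /=.
    by rewrite (le_trans _ (sublinearN_ge x rs))// lerN2.
  have Fs : sublinear (pointwise_inf F).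
    apply: sublinear_pointwise_inf (Fq0) (Flb) _ _.
      move=> _ _ x y [f Af <-] [g Ag <-].
      have [/asboolP fg|/asboolP fg] := Atot _ _ Af Ag.
        exists (sval g); first by exists g.
        by rewrite (le_trans ((svalP g).1.1 _ _))// lerD2r.
      exists (sval f); first by exists f.
      by rewrite (le_trans ((svalP f).1.1 _ _))// lerD2l.
    move=> _ a x [f Af <-] a0; exists (sval f); first by exists f.
    exact: (svalP f).1.2.
  have Fp x : pointwise_inf F x <= p x.
    by rewrite (le_trans (pointwise_inf_le Fq0 (Flb x)))// (svalP q0).2.
  pose bot : T := exist _ (pointwise_inf F) (conj Fs Fp).
  exists bot => s As; apply/asboolP => x /=.
  by apply: pointwise_inf_le => //; exists s.
exists q; split=> // r rs rq x.
have rp z : r z <= p z by exact: le_trans (rq z) (qp z).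
pose r' : T := exist _ r (conj rs rp).
by have /asboolP := qmin r' (asboolT rq); exact.
Qed.

(* A minimal sublinear functional [q] coincides with
   [inf_(t >= 0) (q (x + t y) - t q y)], which at [t = 1] forces additivity.
   Starting from that infimum for [p] and [y = x0] forces [f x0 = p x0]. *)
Lemma dominated_extension p x0 : sublinear p ->
  exists f : V -> R, [/\ {morph f : x y / x + y},
    forall a x, f (emb a *: x) = a * f x,
    forall x, f x <= p x & f x0 = p x0].
Proof.
move=> ps; pose p0 := pointwise_inf (translates p x0).
have p0s : sublinear p0 by exact: sublinear_translates.
have p0p x : p0 x <= p x.
  by have := translates_inf_le x0 x ps (lexx 0);
    rewrite rmorph0 scale0r addr0 mul0r subr0.
have [f [fs fp0 fmin]] := minimal_sublinear p0s.
have fD x y : f (x + y) = f x + f y.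
  apply/le_anti; rewrite fs.1/=.
  have := fmin _ (sublinear_translates y fs) _ x.
  have := translates_inf_le y x fs ler01; rewrite rmorph1 scale1r mul1r.
  move=> h1 /(_ _)/wrap[|h2]; last by lra.
  move=> z; have := translates_inf_le y z fs (lexx 0).
  by rewrite rmorph0 scale0r addr0 mul0r subr0.
have fN x : f (- x) = - f x.
  by apply/eqP; rewrite -addr_eq0 -fD addNr (sublinear0 fs).
exists f; split=> //.
- move=> a x; have [a0|a0] := leP 0 a; first exact: sublinearZ.
  have -> : emb a *: x = - (emb (- a) *: x) by rewrite rmorphN scaleNr opprK.
  by rewrite fN sublinearZ// ?mulNr ?opprK// oppr_ge0 ltW.
- by move=> x; exact: le_trans (fp0 x) (p0p x).
apply/le_anti; rewrite (le_trans (fp0 _) (p0p _))/=.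
(* The translate with [t = 1] gives [f (- x0) <= p 0 - p x0 = - p x0]. *)
have := translates_inf_le x0 (- x0) ps ler01.
have := fp0 (- x0).
rewrite rmorph1 scale1r addNr mul1r (sublinear0 ps) fN -/p0; lra.
Qed.

End HahnBanach.

(** * Separation of points by bounded functionals *)

Definition bounded_functional (K : numFieldType) (X : normedModType K)
    (f : X -> K) : Prop :=
  scalar f /\ exists M : K, forall x, `|f x| <= M * `|x|.

(** Domination by the norm, used at [y] and [- y], bounds [f] by 1, and equality at [x] gives
    [f x = |x|]. *)
Lemma separating_functional_real (R : realType) (X : normedModType R) (x : X) :
  x != 0 -> exists2 f : X -> R, bounded_functional f & f x != 0.
Proof.
move=> x0; pose p (y : X) := `|y|.
have ps : @sublinear R R idfun X p.
  split=> [y z|a y a0]; first exact: ler_normD.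
  by rewrite /p normrZ gtr0_norm.
have [f [fD fZ fp fx]] := dominated_extension x ps.
exists f; last by rewrite fx normr_eq0.
split=> [a y z|]; first by rewrite fD fZ.
exists 1 => y; rewrite mul1r ler_norml fp andbT lerNl.
have -> : - f y = f (- y).
  by rewrite -[- y]scaleN1r -[-1]/(idfun (-1)) fZ mulN1r.
by rewrite (le_trans (fp _))// /p normrN.
Qed.

(* A real-linear [g] is the real part of the complex-linear
   [y |-> g y - i g (i y)]. *)
Lemma separating_functional_complex (R : realType) (X : normedModType R[i])
  (x : X) : x != 0 -> exists2 f : X -> R[i], bounded_functional f & f x != 0.
Proof.
move=> x0; pose p (y : X) : R := complex.Re `|y|.
have pE (y : X) : `|y| = (p y)%:C by rewrite /p RRe_real// normr_real.
have ps : @sublinear R R[i] (real_complex R) X p.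
  split=> [y z|a y a0].
    by rewrite -lecR rmorphD/= -!pE ler_normD.
  by rewrite -lecR rmorphM/= -!pE normrZ gtr0_norm// ltcR.
have [g [gD gZ gp gx]] := dominated_extension x ps.
have gN y : g (- y) = - g y.
  by rewrite -scaleN1r -[-1](rmorphN1 (real_complex R)) gZ mulN1r.
have g_norm y : `|(g y)%:C| <= `|y|.
  rewrite normc_def/= expr0n/= addr0 sqrtr_sqr pE lecR ler_norml gp andbT.
  by rewrite lerNl -gN (le_trans (gp _))// /p normrN.
have giZ y : g ('i *: ('i *: y)) = - g y.
  by rewrite scalerA -expr2 sqr_i scaleN1r gN.
pose f y := (g y)%:C - 'i * (g ('i *: y))%:C.
have fE y : f y = g y +i* (- g ('i *: y)).
  by rewrite /f; simpc.
exists f; last first.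
  apply: contraNneq x0 => fx0; rewrite -normr_eq0 pE -gx.
  by move: fx0; rewrite fE => -[-> _].
split=> [[a b] y z|].
  have aE v : (a +i* b) *: v = a%:C *: v + b%:C *: ('i *: v).
    by rewrite scalerA -scalerDl; congr (_ *: _); simpc.
  rewrite !fE scalerDr !aE scalerDr !gD.
  have sC c v : 'i *: (c%:C *: v) = c%:C *: ('i *: v).
    by rewrite !scalerA mulrC.
  rewrite !sC !gZ giZ; simpc; congr (_ +i* _); ring.
(* Both [g y] and [g (i y)] are at most [|y|] in absolute value. *)
exists 2 => y; rewrite mulr_natl mulr2n (le_trans (ler_normB _ _))// lerD//.
rewrite normrM (le_trans (ler_wpM2l _ (g_norm _)))//.
by rewrite normrZ mulrA -expr2 -normrX sqr_i normrN1 mul1r.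
Qed.

Lemma separating_functional (K : numFieldType) (X : normedModType K) (x : X) :
  real_or_complex K -> x != 0 ->
  exists2 f : X -> K, bounded_functional f & f x != 0.
Proof.
move=> hK; case: hK X x => R X x.
  exact: separating_functional_real.
exact: separating_functional_complex.
Qed.

(** * Rank-one operators and local derivations *)

Section RankOne.
Variables (K : numFieldType) (X : normedModType K).
Implicit Types (f g : X -> K) (x y z : X) (S T U : 'B(X)).

(* The zero operator counts as rank one. *)
Definition rank_one T : Prop :=
  exists x f, bounded_functional f /\ forall y, T y = f y *: x.

Lemma rank_one_subproof x f :
  bounded_functional f -> (fun y => f y *: x) \in @bounded_linear_pred K X.
Proof.
move=> [fL [M fM]]; apply/asboolP; split=> [a y z|].
  by rewrite fL scalerDl scalerA.
exists (M * `|x|) => y; rewrite normrZ mulrAC.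
by rewrite ler_wpM2r.
Qed.

Definition rank_one_op x f (fB : bounded_functional f) : 'B(X) :=
  BoundedOp (rank_one_subproof x fB).

Lemma rank_one_opP x f (fB : bounded_functional f) :
  rank_one (rank_one_op x fB).
Proof. by exists x, f. Qed.

Lemma bounded_functional_comp f T :
  bounded_functional f -> bounded_functional (f \o T).
Proof.
move=> [fL [M fM]]; split=> [a y z|] /=.
  by rewrite bounded_opD bounded_opZ fL.
have [N N0 TN] := bounded_linear_real_bound (bounded_opP T).
(* The sign of [M] is read off at a nonzero vector [T y0]; if [T = 0], the bound 0 serves. *)
have [T0|/existsNP[y0 /eqP Ty0]] := pselect (forall y, T y = 0).
  exists 0 => y /=; rewrite T0 mul0r.
  by have := fM 0; rewrite normr0 mulr0.
have M0 : 0 <= M.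
  have := le_trans (normr_ge0 _) (fM (T y0)).
  by rewrite pmulr_lge0// normr_gt0.
exists (M * N) => y /=.
by rewrite (le_trans (fM _))// -mulrA ler_wpM2l.
Qed.

Lemma bounded_functional_linear f : bounded_functional f ->
  [/\ f 0 = 0, {morph f : y z / y + z} & forall a y, f (a *: y) = a * f y].
Proof.
move=> [fL _].
have fD : {morph f : y z / y + z}.
  by move=> y z; rewrite -[y]scale1r fL mul1r scale1r.
have f0 : f 0 = 0 by apply: (addrI (f 0)); rewrite -fD !addr0.
by split=> // a y; rewrite -[a *: y]addr0 fL f0 addr0.
Qed.

Lemma rank_oneMl S T : rank_one T -> rank_one (S * T).
Proof.
move=> [x [f [fB Tf]]]; exists (S x), f; split=> // y.
by rewrite bounded_op_mulE Tf bounded_opZ.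
Qed.

Lemma rank_oneMr S T : rank_one S -> rank_one (S * T).
Proof.
move=> [x [f [fB Sf]]]; exists x, (f \o T).
split; first exact: bounded_functional_comp.
by move=> y; rewrite bounded_op_mulE Sf.
Qed.

Lemma finite_rank_rank_one T : rank_one T -> finite_rank T.
Proof.
move=> [x [f [fB Tf]]]; have [f0 fD fZ] := bounded_functional_linear fB.
have [fz|/existsNP[z /eqP fz]] := pselect (forall z, f z = 0).
  exists 0, (fun=> 0); apply/seteqP; split=> y [c _ <-].
    by exists (fun=> 0) => //; rewrite big_ord0 Tf fz scale0r.
  by exists 0 => //; rewrite big_ord0 Tf fz scale0r.
exists 1, (fun=> x); apply/seteqP; split=> y [c _ <-].
  by exists (fun=> f c) => //; rewrite big_ord1 Tf.
exists ((c ord0 / f z) *: z) => //.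
by rewrite big_ord1 Tf fZ divfK.
Qed.

(* [x (x) f] is a multiple of an idempotent unless [f x = 0]; in that case
   [x (x) f = (x + z) (x) f - z (x) f] for any [z] with [f z != 0]. *)
Lemma rank_one_ind (P : 'B(X) -> Prop) :
  (forall a S T, P S -> P T -> P (a *: S + T)) ->
  (forall E, rank_one E -> E * E = E -> P E) ->
  forall T, rank_one T -> P T.
Proof.
move=> Plin Pidem T [x [f [fB Tf]]].
have [f0 fD fZ] := bounded_functional_linear fB.
have P0 : P 0.
  apply: Pidem; last by rewrite mul0r.
  by exists 0, f; split=> // y; rewrite scaler0.
have Pnz x' : f x' != 0 -> P (rank_one_op x' fB).
  move=> fx'; pose E := rank_one_op ((f x')^-1 *: x') fB.
  have -> : rank_one_op x' fB = f x' *: E + 0.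
    rewrite addr0; apply: bounded_op_ext => y.
    by rewrite bounded_op_scaleE /= !scalerA mulrAC divff// mul1r.
  apply: Plin => //; apply: Pidem; first exact: rank_one_opP.
  apply: bounded_op_ext => y.
  by rewrite bounded_op_mulE /= !fZ mulVf// mulr1.
have -> : T = rank_one_op x fB by apply: bounded_op_ext => y; rewrite Tf.
have [fx|] := eqVneq (f x) 0; last exact: Pnz.
have [fz|/existsNP[z /eqP fz]] := pselect (forall z, f z = 0).
  have -> // : rank_one_op x fB = 0.
  by apply: bounded_op_ext => y /=; rewrite fz scale0r.
have -> : rank_one_op x fB = (-1) *: rank_one_op z fB + rank_one_op (x + z) fB.
  apply: bounded_op_ext => y; rewrite bounded_op_addE bounded_op_scaleE /=.
  by rewrite scaleN1r scalerDr addrC addrK.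
by apply: Plin; apply: Pnz; rewrite // fD fx add0r.
Qed.

Hypothesis hK : real_or_complex K.

(** If [f (T y) != 0], then [S = T y (x) f] sends [T y] to a nonzero multiple of itself. *)
Lemma rank_one_annihil_l T : (forall S, rank_one S -> S * T = 0) -> T = 0.
Proof.
move=> ST; apply: bounded_op_ext => y; apply/eqP; apply: contrapT => /negP Ty0.
have [f fB fTy] := separating_functional hK Ty0.
have := congr1 (fun U : 'B(X) => U y) (ST _ (rank_one_opP (T y) fB)).
rewrite bounded_op_mulE /= => /eqP.
by rewrite scaler_eq0 (negPf fTy) (negPf Ty0).
Qed.

Lemma rank_one_annihil_r T : (forall S, rank_one S -> T * S = 0) -> T = 0.
Proof.
move=> TS; apply: bounded_op_ext => y; apply/eqP; apply: contrapT => /negP Ty0.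
have [f fB fTy] := separating_functional hK Ty0.
have := congr1 (fun U : 'B(X) => U (T y)) (TS _ (rank_one_opP y fB)).
rewrite bounded_op_mulE /= bounded_opZ => /eqP.
by rewrite scaler_eq0 (negPf fTy) (negPf Ty0).
Qed.

(** * Local derivations on a standard operator algebra *)

Variables (A : {pred 'B(X)}) (delta : 'B(X) -> 'B(X)).
Hypothesis hA : standard_operator_algebra A.
Hypothesis hdelta : local_derivation A delta.

Let AZD a : {in A &, forall S T, a *: S + T \in A}.
Proof. by move=> S T; case: hA => -[_ AL] _ _; exact: AL. Qed.

Let AM : {in A &, forall S T, S * T \in A}.
Proof. by case: hA. Qed.

Let A1 T : rank_one T -> T \in A.
Proof. by case: hA => _ _ AF /finite_rank_rank_one/AF. Qed.

Let AB : {in A &, forall S T, S - T \in A}.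
Proof. by move=> S T SA TA; rewrite addrC -scaleN1r AZD. Qed.

Let deltaL a :
  {in A &, forall S T, delta (a *: S + T) = a *: delta S + delta T}.
Proof. exact: hdelta.1. Qed.

Let deltaB : {in A &, forall S T, delta (S - T) = delta S - delta T}.
Proof.
by move=> S T SA TA; rewrite addrC -scaleN1r deltaL// scaleN1r addrC.
Qed.

(** For the derivation [d] agreeing with [delta] at [T], [0 = d (S T) = d S T + S d T]; right
    multiplication by [U] kills the first term. *)
Lemma local_derivation_annihil S T U :
  S \in A -> T \in A -> S * T = 0 -> T * U = 0 -> S * delta T * U = 0.
Proof.
move=> SA TA ST TU; have [d [dL dM] ->] := hdelta.2 T TA.
have d0 : d 0 = 0.
  by have := dL (-1) T T TA TA; rewrite !scaleN1r !addNr.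
have := congr1 (fun V => V * U) (dM S T SA TA).
by rewrite ST d0 mul0r mulrDl -!mulrA TU mulr0 add0r.
Qed.

Lemma local_derivation_pull_left T U : T \in A -> T * U = 0 ->
  forall S, rank_one S -> delta (S * T) * U = S * delta T * U.
Proof.
move=> TA TU S S1.
(* Membership in [A] is carried through the induction because [delta] is linear only on [A]. *)
suff [] : S \in A /\ delta (S * T) * U = S * delta T * U by [].
elim/rank_one_ind: S / S1 => [a S S' [SA hS] [S'A hS']|P P1 PP].
  split; first exact: AZD.
  rewrite mulrDl -bounded_op_scaleAl deltaL ?AM// !mulrDl -!bounded_op_scaleAl.
  by rewrite hS hS'.
have PA := A1 P1; split=> //.
have PTA := AM PA TA.
apply/eqP; rewrite -subr_eq0; apply/eqP/rank_one_annihil_l => S S1.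
have SA := A1 S1; have SPA := AM SA PA.
(* [S - S * P] stands for [S (1 - P)], since [1 - P] may lie outside [A]. *)
have h1 : (S - S * P) * delta (P * T) * U = 0.
  apply: local_derivation_annihil => //; first exact: AB.
    by rewrite mulrBl -mulrA (mulrA P P) PP subrr.
  by rewrite -mulrA TU mulr0.
have h2 : (S * P) * delta (T - P * T) * U = 0.
  apply: local_derivation_annihil => //; first exact: AB.
    by rewrite mulrBr -!mulrA (mulrA P P) PP subrr.
  by rewrite mulrBl -mulrA TU mulr0 subr0.
move: h1 h2; rewrite deltaB// mulrBr !mulrBl mulrBr => /eqP.
rewrite subr_eq0 => /eqP h1 /eqP; rewrite subr_eq0 => /eqP h2.
by rewrite !mulrA h1 h2 subrr.
Qed.

Lemma local_derivation_sandwich T : T \in A ->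
  forall F G, rank_one F -> rank_one G ->
  delta (F * T * G) = F * delta (T * G) + delta (F * T) * G - F * delta T * G.
Proof.
move=> TA F G F1 G1; have FA := A1 F1; have FTA := AM FA TA.
suff [] : G \in A /\ delta (F * T * G) =
    F * delta (T * G) + delta (F * T) * G - F * delta T * G by [].
elim/rank_one_ind: G / G1 => [a G H [GA hG] [HA hH]|Q Q1 QQ].
  split; first exact: AZD.
  rewrite !mulrDr -!bounded_op_scaleAr !deltaL ?AM// mulrDr -bounded_op_scaleAr.
  rewrite hG hH scalerBr scalerDr.
  by rewrite !opprD -!addrA; congr (_ + _); rewrite [RHS]addrCA; congr (_ + _);
    rewrite [LHS]addrCA; congr (_ + _); rewrite [RHS]addrCA.
have QA := A1 Q1; split=> //; have TQA := AM TA QA.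
have TQQ : T * Q * (1 - Q) = 0 by rewrite mulrBr mulr1 -mulrA QQ subrr.
have TBQ : (T - T * Q) * Q = 0 by rewrite mulrBl -mulrA QQ subrr.
(* This relation yields [delta (F T Q)]; the one for [T - T Q] then rewrites [delta (F T) Q], and
   the remaining terms cancel. *)
have := local_derivation_pull_left TQA TQQ F1; rewrite !mulrBr !mulr1 !mulrA.
move/eqP; rewrite subr_eq => /eqP ->.
have := local_derivation_pull_left (AB TA TQA) TBQ F1.
rewrite mulrBr !deltaB ?AM// mulrBr !mulrBl !mulrA => /eqP.
rewrite subr_eq => /eqP ->; rewrite -!addrA; congr (_ + _).
by rewrite [RHS]addrC !addrA addrNK.
Qed.

(** Multiplying [d E = d E E + E d E] by [E] on both sides gives [E d E E = 2 E d E E]. *)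
Lemma local_derivation_idempotent E : E \in A -> E * E = E ->
  E * delta E * E = 0.
Proof.
move=> EA EE; have [d [_ dM] ->] := hdelta.2 E EA.
have := congr1 (fun V => E * V * E) (dM E E EA EA).
rewrite EE mulrDr mulrDl !mulrA EE -!mulrA EE !mulrA => /eqP.
by rewrite -subr_eq0 opprD addNKr oppr_eq0 => /eqP.
Qed.

Lemma local_derivation_rank_one F G : rank_one F -> rank_one G ->
  delta (F * G) = delta F * G + F * delta G.
Proof.
move=> F1 [y [g [gB Gg]]]; have FA := A1 F1.
have [x [f [fB Ff]]] := F1; have [f0 fD fZ] := bounded_functional_linear fB.
have nz z : f z != 0 -> delta (F * rank_one_op z gB) =
    delta F * rank_one_op z gB + F * delta (rank_one_op z gB).
  move=> fz; set G' := rank_one_op z gB.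
  have G'1 : rank_one G' by exact: rank_one_opP.
  (* [E] shares its functional with [F] and its range with [z (x) g], whence [F E = F] and
     [E G' = G']. *)
  pose E := rank_one_op ((f z)^-1 *: z) fB.
  have EA : E \in A by exact/A1/rank_one_opP.
  have EE : E * E = E.
    apply: bounded_op_ext => w.
    by rewrite bounded_op_mulE /= !fZ mulVf// mulr1.
  have FE : F * E = F.
    apply: bounded_op_ext => w.
    by rewrite bounded_op_mulE !Ff /= !fZ mulVf// mulr1.
  have EG : E * G' = G'.
    apply: bounded_op_ext => w; rewrite bounded_op_mulE /= fZ scalerA.
    by rewrite -mulrA divff// mulr1.
  have := local_derivation_sandwich EA F1 G'1; rewrite FE EG => ->.
  have -> : F * delta E * G' = F * (E * delta E * E) * G'.
    by rewrite !mulrA FE -!mulrA EG.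
  by rewrite local_derivation_idempotent// mulr0 mul0r subr0 addrC.
have -> : G = rank_one_op y gB by apply: bounded_op_ext => w; rewrite Gg.
have [fy|] := eqVneq (f y) 0; last exact: nz.
have [fz|/existsNP[z /eqP fz]] := pselect (forall z, f z = 0).
  have F0 : F = 0 by apply: bounded_op_ext => w; rewrite Ff fz scale0r.
  have d0 : delta 0 = 0 by have := deltaB FA FA; rewrite !subrr.
  by rewrite F0 !mul0r d0 mul0r addr0.
(* As [f y = 0], both [f (y + z)] and [f z] are nonzero, so [nz] applies to each term. *)
have -> : rank_one_op y gB = rank_one_op (y + z) gB - rank_one_op z gB.
  rewrite -scaleN1r; apply: bounded_op_ext => w.
  rewrite bounded_op_addE bounded_op_scaleE /=.
  by rewrite scaleN1r scalerDr addrK.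
have A1' w : rank_one_op w gB \in A by exact/A1/rank_one_opP.
rewrite mulrBr !deltaB ?AM// !nz ?fD ?fy ?add0r// !mulrBr.
by rewrite opprD addrACA.
Qed.

(** For [F] of rank one, so is [F T]; comparing the product rule for [(F T) G] with the sandwich
    identity shows that [F] annihilates the defect. *)
Lemma local_derivation_mul_rank_one T G : T \in A -> rank_one G ->
  delta (T * G) = delta T * G + T * delta G.
Proof.
move=> TA G1; apply/eqP; rewrite -subr_eq0; apply/eqP.
apply: rank_one_annihil_l => F F1.
have := local_derivation_sandwich TA F1 G1.
rewrite local_derivation_rank_one//; last exact: rank_oneMr.
rewrite -addrA [RHS]addrCA => /addrI.
rewrite mulrBr mulrDr !mulrA => ->.
by rewrite [X in _ - X]addrC subrK subrr.
Qed.

End RankOne.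

Theorem theorem2p3 (K : numFieldType) (hK : real_or_complex K)
    (X : completeNormedModType K) (A : {pred 'B(X)})
    (hA : standard_operator_algebra A)
    (delta : 'B(X) -> 'B(X)) (hdelta : local_derivation A delta) :
  derivation A delta.
Proof.
split; first exact: hdelta.1.
move=> S T SA TA; apply/eqP; rewrite -subr_eq0; apply/eqP.
apply: (rank_one_annihil_r hK) => G G1.
have AM : S * T \in A by case: hA => _ AM _; exact: AM.
have dM := local_derivation_mul_rank_one hK hA hdelta.
(* [delta (S T G)] is expanded both as [(S T) G] and as [S (T G)], where [T G] has rank one. *)
have := dM _ _ AM G1; rewrite -mulrA dM//; last exact: rank_oneMl.
rewrite (dM T)// mulrDr !mulrA addrA => /addIr.
by rewrite mulrBl mulrDl => ->; rewrite subrr.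
Qed.
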